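(* Let $\alpha,\beta$ be positive real numbers and let $(\{a_i\}_{i\ge 0},\{b_i\}_{i\ge 0})$ be an ordered pair of non-negative integer sequences which is a proper BCF representation of $(\alpha,\beta)$. Then (i) $a_n\ge 1$ and $a_n\ge b_n$ for all $n\ge 1$; and (ii) for every $n\ge 1$, $a_n=b_n$ implies $b_{n+1}\neq 0$.
   Context: Fibonacci Tree sum: the ordered pair of real numbers $[\{a_0,\ldots,a_{n-1},x\},\{b_0,\ldots,b_{n-1},y\}]$, for $x,y$ positive reals, is defined recursively by $[\{x\},\{y\}]=(x,y)$ and, for $n\ge 1$, $[\{a_0,\ldots,a_{n-1},x\},\{b_0,\ldots,b_{n-1},y\}]=[\{a_0,\ldots,a_{n-2},a_{n-1}+y/x\},\{b_0,\ldots,b_{n-2},b_{n-1}+1/x\}]$. Proper BCF representation: $(\{a_i\}_{i\ge0},\{b_i\}_{i\ge0})$ is a proper BCF representation of $(\alpha,\beta)$ if for every $n\ge 0$ there exist positive reals $\alpha_n,\beta_n$ such that $(\alpha,\beta)=[\{a_0,\ldots,a_{n-1},\alpha_n\},\{b_0,\ldots,b_{n-1},\beta_n\}]$, and $\alpha_n>1$ and $\alpha_n>\beta_n$ for all $n\ge 1$. *)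

(* Defs.v *)
From Stdlib Require Import Reals.
Open Scope R_scope.

(* [fib_tree_sum a b n x y] is the sum
   [{a_0,...,a_(n-1),x},{b_0,...,b_(n-1),y}]; it is meaningful for x, y > 0. *)
Fixpoint fib_tree_sum (a b : nat -> R) (n : nat) (x y : R) : R * R :=
  match n with
  | O => (x, y)
  | S m => fib_tree_sum a b m (a m + y / x) (b m + 1 / x)
  end.

Definition proper_BCF_representation (a b : nat -> R) (alpha beta : R) : Prop :=
  forall n : nat, exists alpha_n beta_n : R,
    0 < alpha_n /\ 0 < beta_n /\
    (alpha, beta) = fib_tree_sum a b n alpha_n beta_n /\
    ((1 <= n)%nat -> 1 < alpha_n /\ beta_n < alpha_n).

(* Main.v *)
Require Import Defs.
From Stdlib Require Import Reals Lra Lia.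
Open Scope R_scope.

(* The map (x, y) |-> (a + y/x, b + 1/x) is injective on positive pairs, so the
   complete quotients (x_n, y_n) of the representation are unique and satisfy
   x_n = a_n + y_(n+1)/x_(n+1) and y_n = b_n + 1/x_(n+1). For n >= 1, properness
   puts both fractions in (0, 1) and gives x_n > 1 and x_n > y_n; integrality of
   a_n and b_n then yields (i). If a_n = b_n, then x_n > y_n forces
   y_(n+1) > 1, whereas b_(n+1) = 0 would give y_(n+1) = 1/x_(n+2) < 1. *)

(** At each level the second coordinate [b n + 1 / x] determines [x], and then the first determines
    [y]. Nonnegative [a], [b] keep the new arguments positive for [IH]. *)
Lemma fib_tree_sum_inj (a b : nat -> R) (ha : forall i, 0 <= a i)
    (hb : forall i, 0 <= b i) (n : nat) :
  forall x y x' y' : R, 0 < x -> 0 < y -> 0 < x' -> 0 < y' ->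
  fib_tree_sum a b n x y = fib_tree_sum a b n x' y' -> x = x' /\ y = y'.
Proof.
  induction n as [|n IH]; simpl; intros x y x' y' Hx Hy Hx' Hy' E.
  - injection E; auto.
  - assert (pos : forall c u v, 0 <= c -> 0 < u -> 0 < v -> 0 < c + u / v).
    { intros c u v Hc Hu Hv. pose proof (Rdiv_lt_0_compat u v Hu Hv). lra. }
    assert (E' := IH _ _ _ _ (pos _ _ _ (ha n) Hy Hx)
                             (pos _ _ _ (hb n) Rlt_0_1 Hx)
                             (pos _ _ _ (ha n) Hy' Hx')
                             (pos _ _ _ (hb n) Rlt_0_1 Hx') E).
    destruct E' as [Ea Eb].
    assert (Ex : x = x').
    { apply Rinv_eq_reg. unfold Rdiv in Eb. lra. }
    split; [exact Ex|].
    subst x'. apply (Rmult_eq_reg_r (/ x)).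
    + unfold Rdiv in Ea. lra.
    + apply Rinv_neq_0_compat. lra.
Qed.

(** The sum at [S n] is by definition a sum at [n], so injectivity applies. *)
Lemma fib_tree_sum_quotient_step (a b : nat -> R) (ha : forall i, 0 <= a i)
    (hb : forall i, 0 <= b i) (n : nat) (x y x' y' : R) :
  0 < x -> 0 < y -> 0 < x' -> 0 < y' ->
  fib_tree_sum a b n x y = fib_tree_sum a b (S n) x' y' ->
  x = a n + y' / x' /\ y = b n + 1 / x'.
Proof.
  intros Hx Hy Hx' Hy' E.
  pose proof (ha n). pose proof (hb n).
  pose proof (Rdiv_lt_0_compat y' x' Hy' Hx').
  pose proof (Rdiv_lt_0_compat 1 x' Rlt_0_1 Hx').
  apply (fib_tree_sum_inj a b ha hb n); try lra.
  exact E.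
Qed.

Lemma Rdiv_lt_1 (u v : R) : 0 < v -> u < v -> u / v < 1.
Proof.
  intros Hv Huv. apply (Rmult_lt_reg_r v); [exact Hv|].
  replace (u / v * v) with u by (field; lra). lra.
Qed.

Theorem lemma6 (alpha beta : R) (halpha : 0 < alpha) (hbeta : 0 < beta)
    (a b : nat -> nat)
    (hrep : proper_BCF_representation
              (fun i => INR (a i)) (fun i => INR (b i)) alpha beta) :
  (forall n : nat, (1 <= n)%nat -> (1 <= a n)%nat /\ (b n <= a n)%nat) /\
  (forall n : nat, (1 <= n)%nat -> a n = b n -> b (n + 1)%nat <> 0%nat).
Proof.
  assert (ha : forall i, 0 <= INR (a i)) by (intro; apply pos_INR).
  assert (hb : forall i, 0 <= INR (b i)) by (intro; apply pos_INR).
  pose proof (fib_tree_sum_quotient_step _ _ ha hb) as step.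
  split; intros n Hn;
    destruct (hrep n) as (x & y & Hx & Hy & E & P);
    destruct (hrep (S n)) as (x' & y' & Hx' & Hy' & E' & P');
    destruct (P Hn) as [Px Pxy];
    destruct (P' ltac:(lia)) as [Px' Pxy'];
    destruct (step n x y x' y') as [Ex Ey]; try assumption; try congruence.
  - pose proof (Rdiv_lt_1 y' x' Hx' Pxy').
    pose proof (Rdiv_lt_0_compat 1 x' Rlt_0_1 Hx').
    split.
    (* [1 <= a n] unfolds to [0 < a n], and [a n = x - y' / x' > 1 - 1]. *)
    + apply INR_lt. simpl. lra.
    (* Here [b n < y < x < a n + 1]. *)
    + apply Nat.lt_succ_r, INR_lt. rewrite S_INR. lra.
  - intros Hab Hb0. rewrite Nat.add_1_r in Hb0.
    destruct (hrep (S (S n))) as (x2 & y2 & Hx2 & Hy2 & E2 & P2).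
    destruct (P2 ltac:(lia)) as [Px2 _].
    destruct (step (S n) x' y' x2 y2) as [_ Ey']; try assumption; try congruence.
    rewrite Hb0 in Ey'. simpl in Ey'.
    pose proof (Rdiv_lt_1 1 x2 Hx2 Px2).
    (* The equal integer parts cancel in [y < x]. *)
    assert (1 / x' < y' / x') by (rewrite Hab in Ex; lra).
    assert (1 < y').
    { apply (Rmult_lt_reg_r (/ x')); [apply Rinv_0_lt_compat; exact Hx'|assumption]. }
    lra.
Qed.
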